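(* Let $G$ be a finitely generated nilpotent group, $H$ a subgroup of $G$ of finite index $[G:H]=m$, $f:H\rightarrow G$ a monomorphism and $[G:H^{f}]=m'$. Furthermore, let $U$ be a subgroup of $H$ and $V=\langle U,U^{f}\rangle$. Suppose $[V:U]=l$ and $[V:U^{f}]=l'$ are finite. Then there exist integers $m_{1}\mid m$ and $m_{1}'\mid m'$ such that $l\,m_{1}'=l'\,m_{1}$.
   Context: For a subgroup $U\leq H$, $U^f$ denotes the image of $U$ under $f$; in particular $H^f$ is the image of $f$ (under these hypotheses the index $[G:H^f]$ is finite). $\langle U,U^f\rangle$ is the subgroup of $G$ generated by $U$ and $U^f$. *)

(* Defs.v *)
From mathcomp Require Import all_boot.
From mathcomp Require Import finmap.
From mathcomp Require Import boolp classical_sets functions cardinality.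

Set Implicit Arguments.
Unset Strict Implicit.
Unset Printing Implicit Defensive.

Local Open Scope classical_set_scope.
Local Open Scope group_scope.

(* Groups are arbitrary (possibly infinite) [groupType]s; subsets and subgroups
   are classical sets. *)

Definition subgroup (G : groupType) (A : set G) : Prop :=
  group_closed (mem A : {pred G}).

Definition generated (G : groupType) (A : set G) : set G :=
  smallest (@subgroup G) A.

Definition finitely_generated (G : groupType) : Prop :=
  exists2 S : set G, finite_set S & generated S = [set: G].

(* [lower_central G n] is the (n+1)-st term of the usual numbering, which
   starts at gamma_1(G) = G. *)
Definition lower_central (G : groupType) (n : nat) : set G :=
  iter n (fun A : set G => generated [set [~ x, y] | x in A & y in [set: G]])
    [set: G].
Arguments lower_central : clear implicits.

Definition nilpotent_group (G : groupType) : Prop :=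
  exists n : nat, lower_central G n = [set 1].

Definition right_cosets (G : groupType) (V U : set G) : set (set G) :=
  [set [set u * x | u in U] | x in V].

Definition finite_index (G : groupType) (V U : set G) : Prop :=
  finite_set (right_cosets V U).

(* The index [V : U], with value 0 exactly when it is infinite (for V nonempty):
   [fset_set] sends infinite sets to the empty finite set. *)
Definition index_in (G : groupType) (V U : set G) : nat :=
  #|` fset_set (right_cosets V U)|.

(* Main.v *)
(* Let I be the set of all roots of U; in a finitely generated nilpotent group
   it is a subgroup containing U with finite index. Since U and f(U) are
   commensurable, f(H /\ I) = f(H) /\ I. Counting [I : U] and [I : f(U)] once
   through V and once through H /\ I, resp. f(H) /\ I, gives the formula with
   m1 = [I : H /\ I] and m1' = [I : f(H) /\ I]. Finally [I : H /\ I] divides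
   [G : H], because H is subnormal: the chain H gamma_i(G) reduces this to the
   case of a normal subgroup. *)
Require Import Defs.
From mathcomp Require Import all_boot.
From mathcomp Require Import finmap.
From mathcomp Require Import boolp classical_sets functions cardinality.

Set Implicit Arguments.
Unset Strict Implicit.
Unset Printing Implicit Defensive.

Local Open Scope classical_set_scope.
Local Open Scope group_scope.

(** The finite index of the root subgroup is where the work lies: a product of two roots of [U] has
    no evident power in [U]. So [I] is taken as the subgroup generated by the roots. Cyclic central
    factors make [G] Noetherian, hence finitely many roots generate [I]. Bilinearity of commutators
    modulo the next lower central term carries the property of having a power in [U] modulo that
    term from these roots to generators of every lower central factor of [I], so finitely many
    cosets of [U] fill [I], and each element of [I] is a root after all. One notion,
    [central_chain], serves both facts. Subnormality is essential for the divisibility: two distinct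
    subgroups of order 2 in the symmetric group on three letters give 2 against 3. *)

(** * Subgroups and generated subgroups as classical sets *)

Lemma subgroupP (G : groupType) (A : set G) :
  subgroup A <-> A 1 /\ forall x y, A x -> A y -> A (x / y).
Proof.
split=> -[A1 AF]; split.
- by move: A1; rewrite in_setE.
- by move=> x y Ax Ay; have := AF x y (mem_set Ax) (mem_set Ay); rewrite in_setE.
- exact: mem_set.
- by move=> x y /set_mem Ax /set_mem Ay; apply/mem_set/AF.
Qed.

Lemma subgroup1 (G : groupType) (A : set G) : subgroup A -> A 1.
Proof. by case/subgroupP. Qed.

Lemma subgroupF (G : groupType) (A : set G) x y :
  subgroup A -> A x -> A y -> A (x / y).
Proof. by case/subgroupP=> _; apply. Qed.

Lemma subgroupV (G : groupType) (A : set G) x : subgroup A -> A x -> A x^-1.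
Proof. by move=> sA Ax; rewrite -div1g; apply: subgroupF => //; apply: subgroup1. Qed.

Lemma subgroupM (G : groupType) (A : set G) x y :
  subgroup A -> A x -> A y -> A (x * y).
Proof. by move=> sA Ax Ay; rewrite -[y]invgK; apply: subgroupF (subgroupV _ _). Qed.

Lemma subgroupX (G : groupType) (A : set G) x n : subgroup A -> A x -> A (x ^+ n).
Proof.
move=> sA Ax; elim: n => [|n IHn]; first exact: subgroup1.
by rewrite expgS; apply: subgroupM.
Qed.

Lemma subgroupJ (G : groupType) (A : set G) x y :
  subgroup A -> A x -> A y -> A (x ^ y).
Proof. by move=> sA Ax Ay; apply: subgroupM (subgroupV _ _) (subgroupM _ _ _). Qed.

Lemma subgroupR (G : groupType) (A : set G) x y :
  subgroup A -> A x -> A y -> A [~ x, y].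
Proof. by move=> sA Ax Ay; apply: subgroupM (subgroupV _ _) (subgroupJ _ _ _). Qed.

Lemma subgroupT (G : groupType) : subgroup [set: G].
Proof. by apply/subgroupP. Qed.

Lemma subgroup_set1 (G : groupType) : subgroup [set 1 : G].
Proof. by apply/subgroupP; split=> // x y -> ->; rewrite /= divg1. Qed.

Lemma subgroupI (G : groupType) (A B : set G) :
  subgroup A -> subgroup B -> subgroup (A `&` B).
Proof.
move=> sA sB; apply/subgroupP; split; first by split; apply: subgroup1.
by move=> x y [Ax Bx] [Ay By]; split; apply: subgroupF.
Qed.

Lemma subgroup_generated (G : groupType) (S : set G) : subgroup (generated S).
Proof.
apply/subgroupP; split=> [M [sM _]|x y Sx Sy M SM]; first exact: subgroup1.
by apply: subgroupF; [case: SM | apply: Sx | apply: Sy].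
Qed.
#[local] Hint Resolve subgroup_generated : core.

Lemma sub_generated (G : groupType) (S : set G) : S `<=` generated S.
Proof. exact: sub_gen_smallest. Qed.

Lemma generated_sub (G : groupType) (S A : set G) :
  subgroup A -> S `<=` A -> generated S `<=` A.
Proof. by move=> sA SA x; apply. Qed.

Lemma generatedS (G : groupType) (S T : set G) :
  S `<=` T -> generated S `<=` generated T.
Proof.
by move=> ST; apply: generated_sub => // x /ST; apply: sub_generated.
Qed.

Lemma generated_id (G : groupType) (A : set G) : subgroup A -> generated A = A.
Proof.
by move=> sA; apply/seteqP; split; [apply: generated_sub | apply: sub_generated].
Qed.

Lemma generated_setU_generated (G : groupType) (S T : set G) :
  generated (generated S `|` T) = generated (S `|` T).
Proof.
apply/seteqP; split.
  apply: generated_sub => // x [|Tx]; last by apply: sub_generated; right.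
  by apply: generatedS => y Sy; left.
by apply: generatedS => x [Sx|Tx]; [left; apply: sub_generated | right].
Qed.

(** * Normalizing sets and product sets *)

Definition normalizes (G : groupType) (A B : set G) : Prop :=
  forall a b, A a -> B b -> B (b ^ a).

Lemma normalizesW (G : groupType) (A A' B : set G) :
  A' `<=` A -> normalizes A B -> normalizes A' B.
Proof. by move=> AA nAB a b /AA; apply: nAB. Qed.

Lemma subgroup_normalizes (G : groupType) (A : set G) :
  subgroup A -> normalizes A A.
Proof. by move=> sA a b Aa Ab; apply: subgroupJ. Qed.

(** Conjugation by [a] is a homomorphism, so the elements it sends into [generated S] form a
    subgroup; checking [S] is enough. *)
Lemma normalizes_generated (G : groupType) (A S : set G) :
  (forall a s, A a -> S s -> generated S (s ^ a)) -> normalizes A (generated S).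
Proof.
move=> AS a b Aa; suff /[apply]: generated S `<=` [set b | generated S (b ^ a)] by [].
apply: generated_sub => [|s Ss]; last exact: AS.
apply/subgroupP; split=> [|x y]; rewrite /= ?conj1g; first exact: subgroup1.
by rewrite conjMg conjVg; apply: subgroupF.
Qed.

Definition mulset (G : groupType) (A B : set G) : set G :=
  [set a * b | a in A & b in B].

Lemma subgroup_mulset (G : groupType) (A B : set G) :
  subgroup A -> subgroup B -> normalizes B A -> subgroup (mulset A B).
Proof.
move=> sA sB nBA; apply/subgroupP; split.
  by exists 1; [exact: subgroup1|exists 1; rewrite ?mulg1//; exact: subgroup1].
move=> _ _ [a Aa [b Bb <-]] [c Ac [d Bd <-]].
(* Moving [c^-1] to the left across [b / d] in [a * b * d^-1 * c^-1] conjugates it by [d * b^-1]. *)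
exists (a * (c^-1) ^ (d * b^-1)).
  apply: subgroupM => //; apply: nBA; last exact: subgroupV.
  exact: subgroupF.
exists (b / d); first exact: subgroupF.
by rewrite conjgE !invgM !invgK !mulgA !mulgVK ?mulgK.
Qed.

Lemma sub_mulsetl (G : groupType) (A B : set G) : subgroup B -> A `<=` mulset A B.
Proof. by move=> sB a Aa; exists a => //; exists 1; rewrite ?mulg1//; exact: subgroup1. Qed.

Lemma sub_mulsetr (G : groupType) (A B : set G) : subgroup A -> B `<=` mulset A B.
Proof. by move=> sA b Bb; exists 1; [exact: subgroup1|exists b; rewrite ?mul1g]. Qed.

Lemma mulset_sub (G : groupType) (A B C : set G) :
  subgroup C -> A `<=` C -> B `<=` C -> mulset A B `<=` C.
Proof. by move=> sC AC BC _ [a /AC Ca [b /BC Cb <-]]; apply: subgroupM. Qed.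

Lemma generated_setU (G : groupType) (A B : set G) :
  subgroup A -> subgroup B -> normalizes B A -> generated (A `|` B) = mulset A B.
Proof.
move=> sA sB nBA; apply/seteqP; split.
  apply: generated_sub; first exact: subgroup_mulset.
  by move=> x [/(sub_mulsetl sB)|/(sub_mulsetr sA)].
by apply: mulset_sub => // x ?; apply: sub_generated; [left|right].
Qed.

(* [T (a / b)] expresses that a and b are congruent modulo T. *)
Lemma divg_eqmodM (G : groupType) (V T : set G) a b c d :
  subgroup V -> subgroup T -> normalizes V T -> V a ->
  T (a / b) -> T (c / d) -> T ((a * c) / (b * d)).
Proof.
move=> sV sT nVT Va Tab Tcd.
have -> : (a * c) / (b * d) = (c / d) ^ a^-1 * (a / b).
  by rewrite conjgE invgM !invgK !mulgA !mulgVK.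
by apply: subgroupM => //; apply: nVT => //; apply: subgroupV.
Qed.

Lemma divg_eqmodV (G : groupType) (V T : set G) a b :
  subgroup T -> normalizes V T -> V a -> T (a / b) -> T (a^-1 / b^-1).
Proof.
move=> sT nVT Va Tab.
have -> : a^-1 / b^-1 = (a / b)^-1 ^ a by rewrite conjgE invgM !invgK mulgVK.
by apply: nVT => //; apply: subgroupV.
Qed.

Lemma divg_eqmodX (G : groupType) (V T : set G) a b n :
  subgroup V -> subgroup T -> normalizes V T -> V a ->
  T (a / b) -> T (a ^+ n / b ^+ n).
Proof.
move=> sV sT nVT Va Tab; elim: n => [|n IHn].
  by rewrite !expg0 divg1; apply: subgroup1.
by rewrite !expgS; apply: (divg_eqmodM sV).
Qed.

Lemma divg_eqmod_trans (G : groupType) (T : set G) a b c :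
  subgroup T -> T (a / b) -> T (b / c) -> T (a / c).
Proof. by move=> sT Tab Tbc; rewrite -(divgKA b); apply: subgroupM. Qed.

Lemma divg_eqmodC (G : groupType) (T : set G) a b :
  subgroup T -> T (a / b) -> T (b / a).
Proof. by move=> sT Tab; rewrite -invgF; apply: subgroupV. Qed.

(** * Commutator calculus modulo a normalized subgroup *)

Lemma commMg (G : groupType) (x y z : G) : [~ x * y, z] = [~ x, z] ^ y * [~ y, z].
Proof. by rewrite /commg !conjgE !invgM !mulgA !mulgK. Qed.

Lemma commVg (G : groupType) (x z : G) : [~ x^-1, z] = ([~ x, z] ^ x^-1)^-1.
Proof.
have := commMg x x^-1 z; rewrite mulgV comm1g => /esym/eqP.
by rewrite mulg_eq1 => /eqP ->; rewrite invgK.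
Qed.

(** By [commMg] and [commVg], commutators of products and inverses are products of conjugates of
    commutators, and [T] absorbs the conjugation. Commutator conditions can thus be checked on
    generators. *)
Lemma subgroup_commgl (G : groupType) (V T : set G) x :
  subgroup V -> subgroup T -> normalizes V T ->
  subgroup [set a | V a /\ T [~ a, x]].
Proof.
move=> sV sT nVT; apply/subgroupP; split=> [|a b [Va Ta] [Vb Tb]].
  by rewrite /= comm1g; split; apply: subgroup1.
split; first exact: subgroupF.
rewrite commMg commVg; apply: subgroupF => //; last first.
  by apply: nVT => //; apply: subgroupV.
by apply: nVT => //; apply: subgroupV.
Qed.

Lemma subgroup_commgr (G : groupType) (V T : set G) a :
  subgroup V -> subgroup T -> normalizes V T ->
  subgroup [set y | V y /\ T [~ a, y]].
Proof.
move=> sV sT nVT; have := subgroup_commgl a sV sT nVT; congr subgroup.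
by apply/seteqP; split=> y [Vy /(subgroupV sT)]; rewrite invgR.
Qed.

(** The last hypothesis makes [[~ a, x]] central modulo [T], so the conjugation in [commMg]
    disappears. *)
Lemma commXg_eqmod (G : groupType) (V T : set G) a x n :
  subgroup V -> subgroup T -> normalizes V T -> V a -> V x ->
  (forall b, V b -> T [~ [~ a, x], b]) -> T ([~ a ^+ n, x] / [~ a, x] ^+ n).
Proof.
move=> sV sT nVT Va Vx Tax; elim: n => [|n IHn].
  by rewrite !expg0 comm1g divg1; apply: subgroup1.
rewrite !expgS commMg; set c := [~ a, x].
have Vc : V c by apply: subgroupR.
apply: (divg_eqmodM sV) => //; first by apply: subgroupJ => //; apply: subgroupX.
have -> : c ^ (a ^+ n) / c = [~ c, a ^+ n] ^ c^-1.
  rewrite (commgEl c); move: (c ^ _) => d; by rewrite conjgE invgK !mulgA mulgV mul1g.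
by apply: nVT (subgroupV sV Vc) (Tax _ (subgroupX n sV Va)).
Qed.

Lemma commgX_eqmod (G : groupType) (V T : set G) a x n :
  subgroup V -> subgroup T -> normalizes V T -> V a -> V x ->
  (forall b, V b -> T [~ [~ x, a], b]) -> T ([~ x, a ^+ n] / [~ x, a] ^+ n).
Proof.
move=> sV sT nVT Va Vx Tax; rewrite -invgR -(invgR a) expVgn.
apply: (divg_eqmodV sT nVT); first by apply: subgroupR => //; apply: subgroupX.
apply: (commXg_eqmod _ sV) => // b Vb.
(* [Tax] concerns [[~ x, a]], the inverse of the commutator required here; the elements centralizing
   [b] modulo [T] are closed under inverses. *)
suff [] : [set c | V c /\ T [~ c, b]] [~ a, x] by [].
rewrite -[[~ a, x]]invgR; apply: subgroupV; first exact: subgroup_commgl.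
by split; [apply: subgroupR | apply: Tax].
Qed.

(** * Lower central series and central chains with cyclic factors *)

(** The lower central series of a subgroup, kept as sets of the ambient [G]. At [[set: G]] it is
    convertible with [lower_central G], so nilpotency of [G] applies to it directly. *)
Definition lcs (G : groupType) (V : set G) (n : nat) : set G :=
  iter n (fun A : set G => generated [set [~ x, y] | x in A & y in V]) V.

Lemma subgroup_lcs (G : groupType) (V : set G) n :
  subgroup V -> subgroup (lcs V n).
Proof. by case: n => [//|n _]; exact: subgroup_generated. Qed.

Lemma lcs_commg (G : groupType) (V : set G) n x y :
  lcs V n x -> V y -> lcs V n.+1 [~ x, y].
Proof. by move=> Vx Vy; apply: sub_generated; exists x => //; exists y. Qed.

Lemma lcs_normal_sub (G : groupType) (V : set G) n :
  subgroup V -> normalizes V (lcs V n) /\ lcs V n `<=` V.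
Proof.
move=> sV; elim: n => [|n [nVn Vn]]; first by split=> //; apply: subgroup_normalizes.
split.
  apply: normalizes_generated => a _ Va [x nx [y Vy <-]].
  by rewrite conjRg; apply: lcs_commg; [apply: nVn | apply: subgroupJ].
by apply: generated_sub => // _ [x /Vn Vx [y Vy <-]]; apply: subgroupR.
Qed.

Lemma lcs_normal (G : groupType) (V : set G) n : subgroup V -> normalizes V (lcs V n).
Proof. by case/(lcs_normal_sub n). Qed.

Lemma lcs_sub (G : groupType) (V : set G) n : subgroup V -> lcs V n `<=` V.
Proof. by case/(lcs_normal_sub n). Qed.

Lemma lcsS_sub (G : groupType) (V : set G) n :
  subgroup V -> lcs V n.+1 `<=` lcs V n.
Proof.
move=> sV; apply: generated_sub; first exact: subgroup_lcs.
move=> _ [x nx [y Vy <-]].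
by apply: (subgroupM (subgroup_lcs n sV) (subgroupV (subgroup_lcs n sV) nx));
   apply: lcs_normal.
Qed.

(** This monotonicity is how nilpotency passes to subgroups. *)
Lemma lcsSl (G : groupType) (V W : set G) n : V `<=` W -> lcs V n `<=` lcs W n.
Proof.
move=> VW; elim: n => //= n IHn; apply: generatedS => _ [x nx [y Vy <-]].
by exists x; [apply: IHn | exists y; [apply: VW|]].
Qed.

(* The terms of central series of V with cyclic factors <N, x> / N, where
   moreover some power of x lies in N U. *)
Inductive central_chain (G : groupType) (V U : set G) : set G -> Prop :=
| central_chain1 : central_chain V U [set 1]
| central_chainS N x n u : central_chain V U N -> V x ->
    (forall y, V y -> N [~ x, y]) -> 0 < n -> U u -> N (x ^+ n / u) ->
    central_chain V U (generated (N `|` [set x])).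

Lemma central_chain_normal (G : groupType) (V U N : set G) :
  subgroup V -> central_chain V U N ->
  [/\ subgroup N, N `<=` V & normalizes V N].
Proof.
move=> sV; elim=> {N} [|N x n u _ [sN NV nVN] Vx cNx _ _ _].
  split; [exact: subgroup_set1 | by move=> _ ->; apply: subgroup1 |].
  by move=> a _ _ ->; rewrite /= conj1g.
split=> //.
  by apply: generated_sub => // y [/NV//|->].
apply: normalizes_generated => y z Vy [Nz|->].
  by apply: sub_generated; left; apply: nVN.
(* Here [x ^ y = x * [~ x, y]], and the commutator lies in [N]. *)
rewrite -[x ^ y](mulKg x^-1) invgK; apply: (subgroupM (subgroup_generated _)).
  by apply: sub_generated; right.
by apply: sub_generated; left; apply: cNx.
Qed.

(** Centrality and the power condition modulo [N] persist modulo any larger term, so the members of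
    [s] can be adjoined one by one. *)
Lemma central_chain_layer (G : groupType) (V U N : set G) (s : seq G) :
  subgroup V -> central_chain V U N ->
  (forall x, x \in s -> V x /\ forall y, V y -> N [~ x, y]) ->
  (forall x, x \in s -> exists n u, [/\ 0 < n, U u & N (x ^+ n / u)]) ->
  central_chain V U (generated (N `|` [set` s])).
Proof.
move=> sV cN; elim: s => [|x s IHs] sC sX.
  rewrite set_nil setU0 generated_id //.
  by case: (central_chain_normal sV cN).
have {IHs}cs : central_chain V U (generated (N `|` [set` s])).
  by apply: IHs => y ys; [apply: sC|apply: sX]; rewrite in_cons ys orbT.
have [Vx Nx] := sC x (mem_head _ _).
have [n [u [n0 Uu Nxn]]] := sX x (mem_head _ _).
have -> : generated (N `|` [set` x :: s]) =
          generated (generated (N `|` [set` s]) `|` [set x]).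
  rewrite generated_setU_generated -setUA; congr (generated (_ `|` _)).
  apply/seteqP; split=> y /=; rewrite in_cons.
    by case/predU1P; [right|left].
  by case=> [->|->]; rewrite ?eqxx ?orbT.
apply: (central_chainS cs Vx _ n0 Uu).
  by move=> y Vy; apply: sub_generated; left; apply: Nx.
by apply: sub_generated; left.
Qed.

(* Write gamma_i for lcs V i. Since gamma_(i+1) / gamma_(i+2) is central,
   [~ a, x] is bilinear modulo gamma_(i+2) for a in gamma_i and x in V. Hence
   gamma_(i+1) is generated modulo gamma_(i+2) by commutators of generators;
   and if a ^+ n lies in gamma_(i+1) U and x ^+ k in U, then [~ a, x] ^+ (n * k)
   lies in gamma_(i+2) U. *)
Lemma lcs_generators (G : groupType) (V U : set G) (X : seq G) i :
  subgroup U -> U `<=` V -> V = generated [set` X] ->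
  (forall x, x \in X -> exists2 k, 0 < k & U (x ^+ k)) ->
  exists s : seq G, [/\ {in s, forall a, lcs V i a},
    {in s, forall a, exists n u, [/\ 0 < n, U u & lcs V i.+1 (a ^+ n / u)]} &
    lcs V i `<=` generated (lcs V i.+1 `|` [set` s])].
Proof.
move=> sU UV VX XU; have sV : subgroup V by rewrite VX.
have VxX x : x \in X -> V x by rewrite VX; apply: sub_generated.
elim: i => [|i [s [s_i s_pow s_gen]]].
  exists X; split=> [//|x /XU[k k0 Uxk]|].
    exists k, (x ^+ k); split=> //; rewrite mulgV.
    exact: (subgroup1 (subgroup_lcs 1 sV)).
  by rewrite /= {1}VX; apply: generatedS => x Xx; right.
set T := lcs V i.+2.
have sT : subgroup T by exact: subgroup_lcs.
have nVT : normalizes V T by exact: lcs_normal.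
have TR c b : lcs V i.+1 c -> V b -> T [~ c, b] by exact: lcs_commg.
exists [seq [~ a, x] | a <- s, x <- X]; split.
- by move=> _ /allpairsP[[a x] /= [/s_i sa /VxX Vx ->]]; apply: lcs_commg.
- move=> _ /allpairsP[[a x] /= [sa Xx ->]].
  have Vx := VxX _ Xx; have ia := s_i _ sa.
  have [n [u [n0 Uu anu]]] := s_pow _ sa.
  have [k k0 Uxk] := XU _ Xx.
  have Va : V a by exact: lcs_sub ia.
  have Vu : V u by exact: UV.
  (* [u] is congruent to [a ^+ n] modulo the next term; its place in gamma_i is what makes
     [[~ u, x]] central modulo [T] in [e3]. *)
  have iu : lcs V i u.
    have -> : u = (a ^+ n / u)^-1 * a ^+ n by rewrite invgF mulgVK.
    apply: subgroupM; first exact: subgroup_lcs.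
      apply: subgroupV; first exact: subgroup_lcs.
      exact: lcsS_sub.
    by apply: subgroupX => //; exact: subgroup_lcs.
  exists (n * k)%N, [~ u, x ^+ k]; split; first by rewrite muln_gt0 n0.
    exact: subgroupR.
  rewrite expgnA.
  (* Modulo [T], [[~ a, x] ^+ (n * k)] becomes [[~ a ^+ n, x] ^+ k], then [[~ u, x] ^+ k], then
     [[~ u, x ^+ k]]. *)
  have e1 : T ([~ a ^+ n, x] / [~ a, x] ^+ n).
    by apply: (commXg_eqmod _ sV) => // b Vb; apply: TR => //; apply: lcs_commg.
  have e2 : T ([~ a ^+ n, x] / [~ u, x]).
    rewrite -{1}[a ^+ n](mulgVK u) commMg mulgK.
    by apply: nVT => //; apply: TR.
  have e3 : T ([~ u, x ^+ k] / [~ u, x] ^+ k).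
    by apply: (commgX_eqmod _ sV) => // b Vb; apply: TR => //; apply: lcs_commg.
  apply: (divg_eqmod_trans sT) (divg_eqmodC sT e3).
  apply: (divg_eqmodX k sV sT nVT (subgroupX n sV (subgroupR sV Va Vx))).
  exact: divg_eqmod_trans (divg_eqmodC sT e1) e2.
set W := generated _.
have sW : subgroup W by exact: subgroup_generated.
have TW : T `<=` W by move=> c Tc; apply: sub_generated; left.
have W_i1 : W `<=` lcs V i.+1.
  apply: generated_sub; first exact: subgroup_lcs.
  move=> c [|/allpairsP[[a x] /= [/s_i sa /VxX Vx ->]]]; first exact: lcsS_sub.
  exact: lcs_commg.
(* [W] lies between two consecutive terms, so [t ^ y = t * [~ t, y]] with [[~ t, y]] in [T]. *)
have nVW : normalizes V W.
  move=> y t Vy Wt; rewrite -[t ^ y](mulKg t^-1) invgK; apply: (subgroupM sW Wt).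
  by apply: TW; apply: TR Vy; apply: (W_i1 _ Wt).
(* Two passes over generators: first [x] in [X] is fixed and [a] varies over gamma_i, then [a] is
   fixed and the second argument varies over [V]. *)
have WX x : x \in X -> lcs V i `<=` [set a | V a /\ W [~ a, x]].
  move=> Xx; apply: subset_trans s_gen _.
  apply: generated_sub => [|a [ia|sa]]; first exact: subgroup_commgl.
    split; first exact: lcs_sub ia.
    by apply: TW; apply: TR (VxX _ Xx).
  split; first exact/(lcs_sub sV)/(s_i _ sa).
  by apply: sub_generated; right; apply/allpairsP; exists (a, x).
apply: generated_sub => // _ [a ia [y Vy <-]].
suff : V `<=` [set y | V y /\ W [~ a, y]] by case/(_ y Vy).
rewrite [X in X `<=` _]VX; apply: generated_sub => [|x Xx].
  exact: subgroup_commgr.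
by split; [exact: VxX | case: (WX x Xx a ia)].
Qed.

Lemma central_chain_nilpotent (G : groupType) (V U : set G) (X : seq G) c :
  lcs V c = [set 1] -> subgroup U -> U `<=` V -> V = generated [set` X] ->
  (forall x, x \in X -> exists2 k, 0 < k & U (x ^+ k)) ->
  central_chain V U V.
Proof.
move=> Vc sU UV VX XU; have sV : subgroup V by rewrite VX.
(* Induction on the distance [j] to the trivial term: the chain is built upward from [[set 1]], one
   lower central factor at a time. *)
suff /(_ 0 c): forall i j, (i + j)%N = c -> central_chain V U (lcs V i) by apply.
move=> i j; elim: j i => [|j IHj] i.
  by rewrite addn0 => ->; rewrite Vc; exact: central_chain1.
rewrite addnS -addSn => /IHj cS.
have [s [s_i s_pow s_gen]] := lcs_generators i sU UV VX XU.
have -> : lcs V i = generated (lcs V i.+1 `|` [set` s]).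
  apply/seteqP; split=> //; apply: generated_sub; first exact: subgroup_lcs.
  by move=> x [|/s_i//]; exact: lcsS_sub.
apply: central_chain_layer => // x /s_i ix; split; first exact: lcs_sub ix.
by move=> y; apply: lcs_commg.
Qed.

(** * Cyclic subgroups modulo a subgroup *)

(** Integer exponents are encoded as differences of naturals; the hypothesis says that [a - b] and
    [c - d] agree as integers. *)
Lemma expg_div_eq (G : groupType) (x : G) a b c d :
  (a + d = c + b)%N -> x ^+ a / x ^+ b = x ^+ c / x ^+ d.
Proof.
move=> e; rewrite -(mulgKA (x ^+ d)) -(mulgKA (x ^+ b) (x ^+ c)) -!expgnDr e.
by rewrite (addnC d).
Qed.

Lemma expg_divM (G : groupType) (x : G) a b c d :
  (x ^+ a / x ^+ b) * (x ^+ c / x ^+ d) = x ^+ (a + c) / x ^+ (b + d).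
Proof.
rewrite !expgnDr invgM !mulgA -!mulgA; congr (_ * _).
rewrite mulgA; have xx k l : commute (x ^+ k) (x ^+ l).
  exact/commuteX2/commute_refl.
rewrite -(commuteV (xx c b)) -mulgA; congr (_ * _).
by rewrite -invgM -(xx b d) invgM.
Qed.

Lemma mem_cycle (G : groupType) (x y : G) :
  generated [set x] y -> exists i j, y = x ^+ i / x ^+ j.
Proof.
move: y; apply: generated_sub => [|_ ->]; last first.
  by exists 1%N, 0; rewrite expg1 expg0 divg1.
apply/subgroupP; split; first by exists 0, 0; rewrite expg0 divg1.
move=> _ _ [i [j ->]] [k [l ->]]; exists (i + l)%N, (j + k)%N.
by rewrite invgF expg_divM.
Qed.

Lemma mem_cycle_mod (G : groupType) (M : set G) (x y : G) n :
  subgroup M -> 0 < n -> M (x ^+ n) -> generated [set x] y ->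
  exists2 r, r < n & M (y / x ^+ r).
Proof.
move=> sM n0 Mxn /mem_cycle[i [j ->]].
(* [e] is a natural number congruent to the integer [i - j] modulo [n]. *)
pose e := (i + j * n.-1)%N; exists (e %% n)%N; first by rewrite ltn_mod.
rewrite -mulgA -invgM -expgnDr.
rewrite (@expg_div_eq _ _ _ _ (n * (e %/ n)) (n * j)); last first.
  rewrite addnA (mulnC n (e %/ n)) -divn_eq /e -addnA; congr addn.
  by rewrite -{1}(prednK n0) mulSn addnC mulnC.
by apply: subgroupF; rewrite // expgnA; apply: subgroupX.
Qed.

Lemma generated_setU1 (G : groupType) (N : set G) (x : G) :
  subgroup N -> normalizes (generated [set x]) N ->
  generated (N `|` [set x]) = mulset N (generated [set x]).
Proof.
move=> sN nxN; rewrite -generated_setU // setUC -generated_setU_generated.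
by rewrite setUC.
Qed.

(** * Finite index and finite generation *)

(** The list only has to cover: it may repeat cosets or leave [A], which makes it easy to supply.
    Exact counting is left to [transversal]. *)
Lemma finite_indexP (G : groupType) (A B : set G) :
  subgroup B ->
  finite_index A B <-> exists t : seq G, forall a, A a -> exists2 r, r \in t & B (a / r).
Proof.
move=> sB; split.
  case/finite_seqP=> cs cosets.
  pose rep (C : set G) : G := xget 1 C; exists [seq rep C | C <- cs] => a Aa.
  have csa : [set b * a | b in B] \in cs.
    have : right_cosets A B [set b * a | b in B] by exists a.
    by rewrite cosets.
  exists (rep [set b * a | b in B]); first exact: map_f.
  rewrite /rep; case: xgetP => [y -> [b Bb <-]|/(_ a)[]].
    by rewrite invgM mulgA mulgV mul1g; apply: subgroupV.
  by exists 1; [exact: subgroup1 | rewrite mul1g].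
case=> t tP; apply: (@sub_finite_set _ _ ((fun r => [set b * r | b in B]) @` [set` t])).
  move=> _ [a Aa <-]; have [r tr Bar] := tP a Aa; exists r => //.
  apply/seteqP; split=> _ [b Bb <-].
    exists (b / (a / r)); first exact: subgroupF.
    by rewrite invgF mulgA mulgVK.
  exists (b * (a / r)); first exact: subgroupM.
  by rewrite mulgA mulgVK.
exact/finite_image/finite_seq.
Qed.

Lemma finite_indexSl (G : groupType) (A A' B : set G) :
  A' `<=` A -> finite_index A B -> finite_index A' B.
Proof. by move=> AA; apply: sub_finite_set => _ [a /AA Aa <-]; exists a. Qed.

Lemma finite_indexSr (G : groupType) (A B B' : set G) :
  subgroup B -> subgroup B' -> B `<=` B' -> finite_index A B -> finite_index A B'.
Proof.
move=> sB sB' BB /(finite_indexP _ sB)[t tP]; apply/finite_indexP => //.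
by exists t => a /tP[r tr /BB]; exists r.
Qed.

(** Pigeonhole: among the powers with exponents 0 to [size t], two share a representative, and the
    difference of their exponents works. *)
Lemma finite_index_expg (G : groupType) (A B : set G) a :
  subgroup A -> subgroup B -> finite_index A B -> A a ->
  exists2 n, 0 < n & B (a ^+ n).
Proof.
move=> sA sB /(finite_indexP _ sB)[t tP] Aa.
have /choice[r rP] : forall k, exists r, r \in t /\ B (a ^+ k / r).
  by move=> k; have [r] := tP _ (subgroupX k sA Aa); exists r.
have : ~~ uniq [seq r k | k <- iota 0 (size t).+1].
  have sub : {subset [seq r k | k <- iota 0 (size t).+1] <= t}.
    by move=> _ /mapP[k _ ->]; case: (rP k).
  by apply/negP => /uniq_leq_size/(_ sub); rewrite size_map size_iota ltnn.
case/(uniqPn 1) => i [j [ij]]; rewrite size_map size_iota => js.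
have si := ltn_trans ij js.
rewrite !(nth_map 0) ?size_iota // !nth_iota // !add0n => rij.
exists (j - i)%N; first by rewrite subn_gt0.
rewrite expgnFr 1?ltnW// -(divgKA (r j)); apply: subgroupM => //.
  by case: (rP j).
by rewrite -rij -invgF; apply: subgroupV => //; case: (rP i).
Qed.

(** [U] need not lie in [N]: what is finite is the number of cosets of [U] that meet [N]. One step
    of the chain multiplies the list of representatives by the powers of [x] below [n]. *)
Lemma central_chain_finite_index (G : groupType) (V U N : set G) :
  subgroup V -> subgroup U -> U `<=` V -> central_chain V U N -> finite_index N U.
Proof.
move=> sV sU UV; elim=> {N} [|N x n u cN IH Vx cNx n0 Uu Nxn].
  apply/finite_indexP => //; exists [:: 1] => a ->; exists 1.
    exact: mem_head.
  by rewrite divg1; apply: subgroup1.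
have [sN NV nVN] := central_chain_normal sV cN.
have [t tP] := (finite_indexP _ sU).1 IH.
have nUN : normalizes U N by apply: normalizesW nVN.
have sM : subgroup (mulset N U) by exact: subgroup_mulset.
have Mxn : mulset N U (x ^+ n) by exists (x ^+ n / u) => //; exists u; rewrite ?mulgVK.
(* Right cosets of [U] want the factor from [U] on the left. *)
have MNU : mulset N U `<=` mulset U N.
  move=> _ [h Nh [v Uv <-]]; exists v => //; exists (h ^ v); first exact: nUN.
  by rewrite -conjgC.
have cV : generated [set x] `<=` V by apply: generated_sub => // _ ->.
apply/finite_indexP => //; exists [seq s * x ^+ r | s <- t, r <- iota 0 n] => g.
rewrite generated_setU1; last 2 first; [exact: sN | exact: normalizesW nVN |].
case=> h Nh [y xy <-]; have [r rn Myr] := mem_cycle_mod sM n0 Mxn xy.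
have [v Uv [k Nk vk]] : mulset U N (h * (y / x ^+ r)).
  by apply: MNU; apply: subgroupM => //; apply: sub_mulsetl.
have [s ts Uks] := tP _ Nk; exists (s * x ^+ r).
  by apply/allpairsP; exists (s, r); rewrite mem_iota.
have -> : h * y / (s * x ^+ r) = v * (k / s) by rewrite mulgA vk invgM !mulgA.
exact: subgroupM.
Qed.

(** The Noetherian property: [K] meets [N] in a finitely generated group by induction, and modulo
    [N] it is cyclic, so at most one more generator suffices. *)
Lemma central_chain_generators (G : groupType) (V U N K : set G) :
  subgroup V -> central_chain V U N -> subgroup K -> K `<=` N ->
  exists s : seq G, K = generated [set` s].
Proof.
move=> sV cN; elim: cN K => {N} [|N x n u cN IH Vx _ _ _ _] K sK KN.
  exists [::]; rewrite set_nil; apply/seteqP; split.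
    by move=> g /KN ->; apply: subgroup1.
  exact: generated_sub.
have [sN NV nVN] := central_chain_normal sV cN.
have cV : generated [set x] `<=` V by apply: generated_sub => // _ ->.
rewrite generated_setU1 // in KN; last exact: normalizesW nVN.
have [s sE] := IH _ (subgroupI sK sN) (@subIsetr _ K N).
have KV g : K g -> V g by case/KN=> h /NV Vh [y /cV Vy <-]; apply: subgroupM.
have Kx g : K g -> exists i j, N (g / (x ^+ i / x ^+ j)).
  case/KN=> h Nh [y /mem_cycle[i [j ->]] <-]; exists i, j.
  by rewrite mulgK.
case: (pselect (exists k, exists g, [/\ 0 < k, K g & N (g / x ^+ k)])); last first.
  (* A negative exponent becomes positive on passing to [g^-1]; so only exponent 0 survives and [K]
     lies in [N]. *)
  move=> noK; exists s; rewrite -sE; apply/seteqP; split=> [g Kg|g []//].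
  split=> //; have [i [j]] := Kx g Kg; case: (ltngtP i j) => ij Ng.
  - case: noK; exists (j - i)%N, g^-1; split; [by rewrite subn_gt0 | exact: subgroupV |].
    rewrite expgnFr 1?ltnW // -(invgF (x ^+ i)).
    by apply: (divg_eqmodV sN nVN) => //; apply: KV.
  - case: noK; exists (i - j)%N, g; split=> //; first by rewrite subn_gt0.
    by rewrite expgnFr 1?ltnW.
  - by move: Ng; rewrite ij mulgV divg1.
move=> exk; pose P k := `[< exists g, [/\ 0 < k, K g & N (g / x ^+ k)] >].
have [k] : exists2 k, P k & forall l, P l -> k <= l.
  have exP : exists k, P k by case: exk => k kP; exists k; apply/asboolP.
  by case: (ex_minnP exP) => k; exists k.
move=> /asboolP[g0 [k0 Kg0 Ng0]] kmin.
exists (g0 :: s); apply/seteqP; split; last first.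
  apply: generated_sub => // g /=; rewrite in_cons => /predU1P[->//|gs].
  suff [] : (K `&` N) g by [].
  by rewrite sE; apply: sub_generated.
set W := generated _; have sW : subgroup W by exact: subgroup_generated.
have Wg0 : W g0 by apply: sub_generated; rewrite /= mem_head.
have KNW : K `&` N `<=` W.
  by rewrite sE; apply: generatedS => y ys; rewrite /= in_cons [_ \in _]ys orbT.
move=> g Kg; have [i [j Ng]] := Kx g Kg.
(* Euclidean division of [i - j] by the least positive exponent [k], shifted by [j * k] to stay in
   the naturals; [h] is [g] corrected by powers of [g0] so that its exponent is [r]. *)
pose e := (i + j * k.-1)%N; pose q := (e %/ k)%N; pose r := (e %% k)%N.
pose h := g * (g0 ^+ j / g0 ^+ q).
have Kh : K h by apply: subgroupM => //; apply: subgroupF => //; apply: subgroupX.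
have Nh : N (h / x ^+ r).
  have -> : x ^+ r = (x ^+ i / x ^+ j) * ((x ^+ k) ^+ j / (x ^+ k) ^+ q).
    rewrite -!expgnA expg_divM -[LHS]divg1 -(expg0 x); apply: expg_div_eq.
    rewrite addn0 addnCA addnC (addnC r) mulnC -divn_eq /e -addnA; congr addn.
    by rewrite -[in RHS](prednK k0) mulSn addnC mulnC.
  apply: (divg_eqmodM sV) => //; first exact: KV.
  apply: (divg_eqmodM sV) => //; first exact: (KV _ (subgroupX j sK Kg0)).
    by apply: (divg_eqmodX _ sV) => //; apply: KV.
  apply: (divg_eqmodV sN nVN); first exact: (KV _ (subgroupX q sK Kg0)).
  by apply: (divg_eqmodX _ sV) => //; apply: KV.
have r0 : r = 0.
  apply/eqP; rewrite -leqn0 leqNgt; apply/negP => r0.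
  have /kmin : P r by apply/asboolP; exists h.
  by rewrite leqNgt ltn_mod k0.
have Wh : W h by apply: KNW; split=> //; move: Nh; rewrite r0 expg0 divg1.
rewrite -(mulgK (g0 ^+ j / g0 ^+ q) g); apply: (subgroupF sW Wh).
exact: (subgroupF sW (subgroupX j sW Wg0) (subgroupX q sW Wg0)).
Qed.

(** Elements generated by some finite part of [S] form a subgroup, by concatenation of lists; so
    each member of [s] involves only finitely many elements of [S]. Applied to roots, this gives a
    finite generating list of roots. *)
Lemma generated_finite_subset (G : groupType) (S : set G) (s : seq G) :
  generated S = generated [set` s] ->
  exists2 t : seq G, [set` t] `<=` S & generated S = generated [set` t].
Proof.
move=> Ss; pose F := [set g | exists2 t : seq G, [set` t] `<=` S & generated [set` t] g].
have catP (t u : seq G) : [set` t ++ u] = [set` t] `|` [set` u].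
  by apply/seteqP; split=> x; rewrite /= mem_cat => /orP.
have SF : generated S `<=` F.
  apply: generated_sub => [|x Sx]; last first.
    exists [:: x]; first by move=> y; rewrite /= inE => /eqP ->.
    by apply: sub_generated; rewrite /= mem_head.
  apply/subgroupP; split.
    by exists [::] => //; apply: (subgroup1 (subgroup_generated _)).
  move=> x y [t tS tx] [u uS uy]; exists (t ++ u); first by rewrite catP subUset.
  by apply: (subgroupF (subgroup_generated _));
     rewrite catP; [move: tx | move: uy]; apply: generatedS => z; [left | right].
have [t tS st] : exists2 t : seq G, [set` t] `<=` S & [set` s] `<=` generated [set` t].
  have {Ss} : [set` s] `<=` generated S by rewrite Ss; apply: sub_generated.
  elim: s => [|x s IHs] sS; first by exists [::].
  have [y ys|t tS st] := IHs; first by apply: sS; rewrite /= in_cons [_ \in _]ys orbT.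
  have [u uS ux] := SF x (sS x (mem_head _ _)).
  exists (u ++ t); rewrite catP ?subUset// => y /=.
  rewrite in_cons => /predU1P[->|/st]; last by apply: generatedS => z; right.
  by apply: generatedS ux => z; left.
exists t => //; apply/seteqP; split; last exact: generatedS.
by rewrite Ss; apply: generated_sub.
Qed.

(** * The subgroup generated by the roots *)

Lemma nilpotent_isolator (G : groupType) (U : set G) :
  finitely_generated G -> nilpotent_group G -> subgroup U ->
  exists I : set G, [/\ subgroup I, U `<=` I, finite_index I U &
    forall g n, 0 < n -> U (g ^+ n) -> I g].
Proof.
case=> _ /finite_seqP[X ->] GX [c Gc] sU.
pose R := [set g | exists2 n, 0 < n & U (g ^+ n)]; pose I := generated R.
have sI : subgroup I by exact: subgroup_generated.
have UI : U `<=` I.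
  by move=> u Uu; apply: sub_generated; exists 1%N; rewrite ?expg1.
(* With the whole group in the role of [U] the power condition is trivial; only the cyclic central
   factors matter here. *)
have GG : central_chain [set: G] [set: G] [set: G].
  apply: (central_chain_nilpotent Gc (subgroupT G) _ (esym GX)) => //.
  by move=> x _; exists 1%N.
have [s Is] := central_chain_generators (subgroupT G) GG sI (@subsetT _ _).
have [t tR It] := generated_finite_subset Is.
have Ic : lcs I c = [set 1].
  apply/seteqP; split; last by move=> _ ->; apply: (subgroup1 (subgroup_lcs c sI)).
  by rewrite -Gc; apply: lcsSl.
have II := central_chain_nilpotent Ic sU UI It tR.
exists I; split=> //; first exact: central_chain_finite_index sI sU UI II.
by move=> g n n0 Ugn; apply: sub_generated; exists n.
Qed.

(** * Transversals and index arithmetic *)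

(** Exactly one representative, taken in [A], for each coset of [B] that meets [A]; the size is
    [index_in A B] even when [B] is not inside [A]. *)
Definition transversal (G : groupType) (A B : set G) (t : seq G) : Prop :=
  [/\ uniq t, {in t, forall r, A r},
      forall a, A a -> exists2 r, r \in t & B (a / r) &
      {in t &, forall r s, B (r / s) -> r = s}].

Lemma rcoset_eqP (G : groupType) (B : set G) x y : subgroup B ->
  [set b * x | b in B] = [set b * y | b in B] <-> B (x / y).
Proof.
move=> sB; split=> [e|Bxy].
  have : [set b * y | b in B] x.
    by rewrite -e; exists 1; [exact: subgroup1 | rewrite mul1g].
  by case=> b Bb <-; rewrite mulgK.
apply/seteqP; split=> _ [b Bb <-].
  exists (b * (x / y)); first exact: subgroupM.
  by rewrite mulgA mulgVK.
exists (b / (x / y)); first exact: subgroupF.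
by rewrite invgF mulgA mulgVK.
Qed.

Lemma transversal_index (G : groupType) (A B : set G) (t : seq G) : subgroup B ->
  transversal A B t -> finite_index A B /\ index_in A B = size t.
Proof.
move=> sB [tU tA At tinj].
pose s := [seq [set b * r | b in B] | r <- t].
have sU : uniq s.
  by rewrite map_inj_in_uniq // => x y xt yt /(rcoset_eqP _ _ sB); apply: tinj.
have cosets : right_cosets A B = [set` s].
  apply/seteqP; split=> [_ [a Aa <-]|C /mapP[r /tA Ar ->]]; last by exists r.
  by have [r rt /(rcoset_eqP _ _ sB) e] := At a Aa; apply/mapP; exists r.
split; first by rewrite /finite_index cosets; apply: finite_seq.
rewrite /index_in cosets.
have -> : [set` s] = [set` [fset C in s]%fset].
  by apply/seteqP; split=> C /=; rewrite !inE.
by rewrite set_fsetK card_fseq undup_id // size_map.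
Qed.

Lemma transversal_exists (G : groupType) (A B : set G) : subgroup B ->
  finite_index A B -> exists t, transversal A B t.
Proof.
move=> sB /finite_seqP[cs0 cosets].
pose cs := undup cs0.
have csP (C : set G) : C \in cs <-> right_cosets A B C by rewrite cosets mem_undup.
pose rep (C : set G) : G := xget 1 [set x | A x /\ C = [set b * x | b in B]].
have repP C : C \in cs -> A (rep C) /\ C = [set b * rep C | b in B].
  move=> /csP[a Aa Ca]; rewrite /rep; case: xgetP => [y -> //|/(_ a)[]].
  by split; rewrite ?Ca.
exists [seq rep C | C <- cs]; split.
- rewrite map_inj_in_uniq ?undup_uniq// => C D /repP[_ {2}->] /repP[_ {2}->].
  by move=> ->.
- by move=> _ /mapP[C /repP[AC _] ->].
- move=> a Aa; pose C := [set b * a | b in B].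
  have csC : C \in cs by apply/csP; exists a.
  exists (rep C); first exact: map_f.
  by apply/(rcoset_eqP _ _ sB); case: (repP _ csC).
- move=> _ _ /mapP[C csC ->] /mapP[D csD ->] /(rcoset_eqP _ _ sB).
  by case: (repP _ csC) => _ <-; case: (repP _ csD) => _ <- ->.
Qed.

Lemma index_tower (G : groupType) (A B C : set G) :
  subgroup A -> subgroup B -> subgroup C -> C `<=` B -> B `<=` A ->
  finite_index A B -> finite_index B C ->
  finite_index A C /\ index_in A C = (index_in A B * index_in B C)%N.
Proof.
move=> sA sB sC CB BA fAB fBC.
have [t tT] := transversal_exists sB fAB; have [u uT] := transversal_exists sC fBC.
rewrite (transversal_index sB tT).2 (transversal_index sC uT).2.
case: tT uT => tU tA At tinj [uU uB Bu uinj].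
(* [C] lies in [B], so congruence of the products modulo [C] first forces [x = x'] through [B]; then
   [x] cancels and [y = y']. *)
have vinj x y x' y' : x \in t -> y \in u -> x' \in t -> y' \in u ->
    C (y * x / (y' * x')) -> (x, y) = (x', y').
  move=> xt yu xt' yu' Cxy; have xx : x = x'.
    apply: tinj => //; have -> : x / x' = y^-1 * (y * x / (y' * x')) * y'.
      by rewrite invgM !mulgA mulVg mul1g mulgVK.
    apply: (subgroupM sB _ (uB _ yu')); apply: (subgroupM sB _ (CB _ Cxy)).
    exact: (subgroupV sB (uB _ yu)).
  by move: Cxy; rewrite xx mulgKA => /uinj ->.
rewrite -(size_allpairs (fun x y => y * x)); apply: transversal_index => //; split.
- apply: allpairs_uniq => // _ q /allpairsP[[x y] /= [xt yu ->]].
  case/allpairsP=> -[x' y'] /= [xt' yu' ->] /= e.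
  by apply: vinj => //; rewrite e mulgV; apply: subgroup1.
- by move=> _ /allpairsP[[x y] /= [/tA Ax /uB/BA Ay ->]]; apply: (subgroupM sA Ay Ax).
- move=> a Aa; have [x xt Bax] := At a Aa; have [y yu Caxy] := Bu _ Bax.
  exists (y * x); first by apply/allpairsP; exists (x, y).
  by rewrite invgM mulgA.
- move=> _ b /allpairsP[[x y] /= [xt yu ->]].
  case/allpairsP=> -[x' y'] /= [xt' yu' ->] Cxy.
  by have [-> ->] := vinj _ _ _ _ xt yu xt' yu' Cxy.
Qed.

Lemma index_self (G : groupType) (A : set G) :
  subgroup A -> finite_index A A /\ index_in A A = 1%N.
Proof.
move=> sA; apply: (@transversal_index _ _ _ [:: 1]) => //; split=> //.
- by move=> r; rewrite inE => /eqP ->; apply: subgroup1.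
- by move=> a Aa; exists 1; rewrite ?mem_head // divg1.
- by move=> r s; rewrite !inE => /eqP -> /eqP ->.
Qed.

Lemma index_gt0 (G : groupType) (A B : set G) :
  subgroup A -> subgroup B -> finite_index A B -> 0 < index_in A B.
Proof.
move=> sA sB /(transversal_exists sB)[t tT].
rewrite (transversal_index sB tT).2; case: tT => _ _ /(_ 1 (subgroup1 sA))[r + _] _.
by case: t.
Qed.

(** For [a] and [r] in [A] the quotient [a / r] is in [A] anyway, so one transversal serves both
    indices. *)
Lemma index_setI (G : groupType) (A B : set G) :
  subgroup A -> subgroup B -> finite_index A B ->
  finite_index A (A `&` B) /\ index_in A (A `&` B) = index_in A B.
Proof.
move=> sA sB /(transversal_exists sB)[t tT]; rewrite (transversal_index sB tT).2.
case: tT => tU tA At tinj; apply: transversal_index; first exact: subgroupI.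
split=> // [a Aa|r s rt st []]; last by move=> _; apply: tinj.
have [r rt Bar] := At a Aa; exists r => //; split=> //.
exact: (subgroupF sA Aa (tA _ rt)).
Qed.

(** * Second isomorphism theorem and divisibility of indices *)

Lemma right_cosets_mulset (G : groupType) (A B : set G) :
  subgroup B -> right_cosets (mulset B A) B = right_cosets A B.
Proof.
move=> sB; apply/seteqP; split=> [_ [_ [b Bb [a Aa <-]] <-]|_ [a Aa <-]].
  exists a => //; apply/(rcoset_eqP _ _ sB).
  by rewrite invgM mulgA mulgV mul1g; apply: subgroupV.
by exists a => //; apply: sub_mulsetr.
Qed.

(* (A /\ B) / (A /\ C) embeds in B / C. *)
Lemma index_setI_dvd_normal (G : groupType) (A B C : set G) :
  subgroup A -> subgroup B -> subgroup C -> C `<=` B -> normalizes B C ->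
  finite_index B C -> finite_index (A `&` B) (A `&` C) /\
  index_in (A `&` B) (A `&` C) %| index_in B C.
Proof.
move=> sA sB sC CB nBC fBC; set D := A `&` B.
have sD : subgroup D by exact: subgroupI.
have DB : D `<=` B by exact: subIsetr.
have -> : A `&` C = D `&` C by rewrite -setIA (setIidr CB).
have [fD ->] := index_setI sD sC (finite_indexSl DB fBC).
(* [E] sits between [C] and [B], and the cosets of [C] in [E] are those met by [D]; so the index
   sought is the factor [E : C] of [B : C]. *)
split=> //; pose E := mulset C D.
have sE : subgroup E by apply: subgroup_mulset => //; apply: normalizesW nBC.
have CE : C `<=` E by exact: sub_mulsetl.
have EB : E `<=` B by exact: mulset_sub.
have [_ ->] := index_tower sB sE sC CE EB (finite_indexSr sC sE CE fBC)
  (finite_indexSl EB fBC).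
by rewrite /index_in right_cosets_mulset // dvdn_mull.
Qed.

Lemma nilpotent_index_dvd (G : groupType) (A H : set G) :
  nilpotent_group G -> subgroup A -> subgroup H -> finite_index [set: G] H ->
  index_in A (A `&` H) %| index_in [set: G] H.
Proof.
move=> [c Gc] sA sH fH; have sT := subgroupT G.
pose L i := mulset H (lcs [set: G] i).
have sl i : subgroup (lcs [set: G] i) by exact: subgroup_lcs.
have nl i : normalizes [set: G] (lcs [set: G] i) by exact: lcs_normal.
have generatedL i : L i = mulset (lcs [set: G] i) H.
  rewrite /L; apply/seteqP; split=> _ [a Ha [b Hb <-]].
    by exists (b ^ a^-1); [apply: nl|exists a; rewrite // -conjgCV].
  by exists b => //; exists (a ^ b); [apply: nl|rewrite -conjgC].
have sL i : subgroup (L i).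
  by rewrite generatedL; apply: subgroup_mulset => //; apply: normalizesW (nl i).
have HL i : H `<=` L i by exact: sub_mulsetl.
have fL i : finite_index [set: G] (L i) by exact: finite_indexSr (fH).
have LS i : L i.+1 `<=` L i.
  by move=> _ [h Hh [z /(lcsS_sub sT) zi <-]]; exists h => //; exists z.
(* After conjugation by [h] in [H], which is inside [L i.+1], conjugation by [z] in gamma_i only
   adds a commutator from gamma_(i+1). *)
have nL i : normalizes (L i) (L i.+1).
  move=> _ b [h Hh [z zi <-]] Lb; rewrite conjgM.
  have {}Lb : L i.+1 (b ^ h) by apply: (subgroupJ (sL _) Lb); apply: HL.
  rewrite -[_ ^ z](mulKg (b ^ h)^-1) invgK.
  apply: (subgroupM (sL _) Lb); apply: (sub_mulsetr sH).
  by rewrite -commgEl -invgR; apply: (subgroupV (sl _)); apply: lcs_commg.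
have LT : L 0 = [set: G] by apply/seteqP; split=> // x _; exact: sub_mulsetr.
have LH : L c = H.
  apply/seteqP; split=> //; apply: mulset_sub => //.
  by rewrite (Gc : lcs _ _ = _) => _ ->; apply: subgroup1.
suff : forall i, finite_index A (A `&` L i) /\
    index_in A (A `&` L i) %| index_in [set: G] (L i).
  by case/(_ c); rewrite LH.
elim=> [|i [fi di]].
  by rewrite LT setIT; have [fA ->] := index_self sA; rewrite dvd1n.
have fLi : finite_index (L i) (L i.+1) by apply: finite_indexSl (fL _).
have [fAi dAi] := index_setI_dvd_normal sA (sL i) (sL i.+1) (LS i) (nL i) fLi.
have [fASi ->] := index_tower sA (subgroupI sA (sL i)) (subgroupI sA (sL i.+1))
  (setIS (LS i)) (@subIsetl _ _ _) fi fAi.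
have [_ ->] := index_tower sT (sL i) (sL i.+1) (LS i) (@subsetT _ _) (fL i) fLi.
by split=> //; apply: dvdn_mul.
Qed.

(** * Homomorphisms defined on a subgroup, and the index formula *)

Lemma morph_in1 (G K : groupType) (A : set G) (f : G -> K) :
  {in A &, {morph f : x y / x * y}} -> subgroup A -> f 1 = 1.
Proof.
move=> fM /subgroup1/mem_set A1; apply: (@mulgI _ (f 1)).
by rewrite -fM // !mulg1.
Qed.

Lemma morph_inF (G K : groupType) (A : set G) (f : G -> K) :
  {in A &, {morph f : x y / x * y}} -> subgroup A ->
  {in A &, {morph f : x y / x / y}}.
Proof.
move=> fM sA x y Ax Ay; apply: (@mulIg _ (f y)).
by rewrite -fM ?mulgVK // mem_set //; apply: subgroupF; rewrite // -in_setE.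
Qed.

Lemma morph_inX (G K : groupType) (A : set G) (f : G -> K) n :
  {in A &, {morph f : x y / x * y}} -> subgroup A ->
  {in A, {morph f : x / x ^+ n}}.
Proof.
move=> fM sA x Ax; elim: n => [|n IHn]; first exact: morph_in1 sA.
by rewrite !expgS fM ?IHn // mem_set //; apply: subgroupX; rewrite // -in_setE.
Qed.

Lemma subgroup_image (G K : groupType) (A B : set G) (f : G -> K) :
  {in A &, {morph f : x y / x * y}} -> subgroup A -> subgroup B -> B `<=` A ->
  subgroup (f @` B).
Proof.
move=> fM sA sB BA; apply/subgroupP; split.
  by exists 1; [exact: subgroup1 | exact: morph_in1 sA].
move=> _ _ [x Bx <-] [y By <-]; exists (x / y); first exact: subgroupF.
by apply: (morph_inF fM sA); apply/mem_set/BA.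
Qed.

Lemma index_image (G K : groupType) (A B : set G) (f : G -> K) :
  {in A &, {morph f : x y / x * y}} -> {in A &, injective f} ->
  subgroup A -> subgroup B -> B `<=` A -> finite_index A B ->
  index_in (f @` A) (f @` B) = index_in A B.
Proof.
move=> fM fI sA sB BA /(transversal_exists sB)[t tT].
rewrite (transversal_index sB tT).2 -(size_map f).
case: tT => tU tA At tinj; have At' r : r \in t -> r \in A by move=> /tA/mem_set.
have sfB : subgroup (f @` B) by exact: subgroup_image sA sB BA.
apply: (fun h => (transversal_index sfB h).2); split.
- by rewrite map_inj_in_uniq // => x y /At' Ax /At' Ay; apply: fI.
- by move=> _ /mapP[r /tA Ar ->]; exists r.
- move=> _ [a Aa <-]; have [r rt Bar] := At a Aa.
  exists (f r); first exact: map_f.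
  by exists (a / r) => //; apply: (morph_inF fM sA); [apply/mem_set | apply: At'].
- move=> _ b /mapP[x xt ->] /mapP[y yt ->] [z Bz].
  have [Ax Ay] := (At' _ xt, At' _ yt).
  rewrite -(morph_inF fM sA) // => /fI zxy; congr (f _); apply: tinj => //.
  rewrite -zxy //; apply/mem_set; first exact: BA.
  exact: (subgroupF sA (tA _ xt) (tA _ yt)).
Qed.

(* The monomorphism f : H -> G is given by a total function whose values
   outside H are irrelevant. *)
Theorem theorem4 (G : groupType) (H U V : set G) (f : G -> G)
    (m m' l l' : nat) :
  finitely_generated G -> nilpotent_group G ->
  subgroup H -> finite_index [set: G] H -> index_in [set: G] H = m ->
  {in H &, {morph f : x y / x * y}} -> {in H &, injective f} ->
  index_in [set: G] (f @` H) = m' ->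
  subgroup U -> U `<=` H -> V = generated (U `|` f @` U) ->
  finite_index V U -> index_in V U = l ->
  finite_index V (f @` U) -> index_in V (f @` U) = l' ->
  exists m1 m1' : nat, [/\ m1 %| m, m1' %| m' & l * m1' = l' * m1]%N.
Proof.
move=> fgG nilG sH fH <- fM fI <- sU UH Vgen fVU <- fVfU <-.
have [I [sI UI fIU rootI]] := nilpotent_isolator fgG nilG sU.
have sV : subgroup V by rewrite Vgen; exact: subgroup_generated.
have UV : U `<=` V by move=> u Uu; rewrite Vgen; apply: sub_generated; left.
have fUV : f @` U `<=` V by move=> u Uu; rewrite Vgen; apply: sub_generated; right.
have sfU : subgroup (f @` U) by exact: (subgroup_image fM sH).
have sfH : subgroup (f @` H) by exact: (subgroup_image fM sH).
have VI : V `<=` I.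
  by move=> v /(finite_index_expg sV sU fVU)[n n0 Uvn]; exact: rootI n0 Uvn.
pose J := H `&` I; have sJ : subgroup J by exact: subgroupI.
have JH : J `<=` H by exact: subIsetl.
have UJ : U `<=` J by move=> u Uu; split; [exact: UH | exact: UI].
have fX h n : H h -> f (h ^+ n) = f h ^+ n.
  by move=> Hh; apply: (morph_inX n fM sH); apply: mem_set.
have fJ : I `&` f @` H = f @` J.
  apply/seteqP; split=> [y [Iy [h Hh hE]] | _ [h [Hh Ih] <-]].
    move: Iy; rewrite -hE.
    case/(finite_index_expg sI sU fIU) => n n0 /UV.
    case/(finite_index_expg sV sfU fVfU) => k k0.
    rewrite -expgnA -fX // => -[u Uu] /fI e; exists h => //; split=> //.
    apply: (rootI _ (n * k)%N); first by rewrite muln_gt0 n0.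
    by rewrite -e //; apply/mem_set; [exact: UH | exact: subgroupX].
  split; last by exists h.
  have [n n0 Uhn] := finite_index_expg sI sU fIU Ih.
  have [|k k0] := finite_index_expg (a := f h ^+ n) sV sU fVU.
    by rewrite -fX //; apply: fUV; exists (h ^+ n).
  by rewrite -expgnA; apply: rootI; rewrite muln_gt0 n0.
have sfJ : subgroup (f @` J) by exact: (subgroup_image fM sH).
have fUJ : f @` U `<=` f @` J by exact: image_subset.
have fJI : f @` J `<=` I by rewrite -fJ; exact: subIsetl.
have fIV := finite_indexSr sU sV UV fIU.
have fIJ := finite_indexSr sU sJ UJ fIU.
have fJU : finite_index J U by apply: finite_indexSl fIU; exact: subIsetr.
have [_ eU] := index_tower sI sV sU UV VI fIV fVU.
have [_ eUJ] := index_tower sI sJ sU UJ (@subIsetr _ _ _) fIJ fJU.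
have [fIfU efU] := index_tower sI sV sfU fUV VI fIV fVfU.
have fIfJ := finite_indexSr sfU sfJ fUJ fIfU.
have [_ efUJ] := index_tower sI sfJ sfU fUJ fJI fIfJ (finite_indexSl fJI fIfU).
have eJ : index_in (f @` J) (f @` U) = index_in J U.
  by apply: index_image => // x y /set_mem/JH/mem_set Hx /set_mem/JH/mem_set Hy;
     [apply: fM | apply: fI].
exists (index_in I J), (index_in I (f @` J)); split.
- by rewrite /J setIC; apply: nilpotent_index_dvd.
(* An infinite index is encoded as 0, which every number divides. *)
- have [fin|nfin] := pselect (finite_index [set: G] (f @` H)).
    by rewrite -fJ; apply: nilpotent_index_dvd.
  suff -> : index_in [set: G] (f @` H) = 0 by rewrite dvdn0.
  by rewrite /index_in /fset_set; case: pselect.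
(* Multiplied by the positive index [I : V], both sides become the product of [I : J], [J : U] and
   [I : f(J)]. *)
apply/eqP; rewrite -(eqn_pmul2l (index_gt0 sI sV fIV)) !mulnA -eU -efU eUJ efUJ eJ.
by rewrite mulnAC [eqbRHS]mulnAC (mulnC (index_in I J)).
Qed.
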